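(* Let $q$ be an odd prime power, let $V=\mathbb{F}_q^4$, and let $\langle\ ,\ \rangle$ be a non-degenerate symmetric bilinear form on $V$ over $\mathbb{F}_q$. Let $\mathbf{G}$ be the incidence matrix of $\mathbf{P}(V)$ associated to this form, let $I$ and $A$ be the sets of isotropic and anisotropic elements of $\mathbf{P}(V)$ respectively, and let $\mathbf{G}_{II}=\mathbf{G}|_{I\times I}$ and $\mathbf{G}_{AA}=\mathbf{G}|_{A\times A}$. Then $\mathbf{G}_{II}$ and $\mathbf{G}_{AA}$, viewed as matrices over $\mathbb{F}_2$, are both of full rank, i.e. the rank of $\mathbf{G}_{II}$ over $\mathbb{F}_2$ is $|I|$ and the rank of $\mathbf{G}_{AA}$ over $\mathbb{F}_2$ is $|A|$.
   Context: $\mathbf{P}(V)$ denotes the set of 1-dimensional subspaces of $V$; for a nonzero $X\in V$, $\bar X\in\mathbf{P}(V)$ is the subspace spanned by $X$. The quadratic form corresponding to the bilinear form is $Q(X)=\langle X,X\rangle$. An element $\bar X\in\mathbf{P}(V)$ is called isotropic if $Q(X)=0$ and anisotropic if $Q(X)\neq 0$. We write $\bar X\perp\bar Y$ if $\langle X,Y\rangle=0$. The incidence matrix $\mathbf{G}$ has rows and columns indexed by $\mathbf{P}(V)$, with entry $\mathbf{G}(\bar X,\bar Y)=1$ if $\bar X\perp\bar Y$ and $0$ otherwise. $\mathbf{G}|_{I\times I}$ (resp. $\mathbf{G}|_{A\times A}$) is the submatrix with rows and columns indexed by $I$ (resp. $A$). *)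

(* Defs.v *)
From HB Require Import structures.
From mathcomp Require Import all_boot all_algebra.

Set Implicit Arguments.
Unset Strict Implicit.
Unset Printing Implicit Defensive.

Import GRing.Theory.
Local Open Scope ring_scope.

Section FiniteSubspaces.
Import VectorInternalTheory.

HB.instance Definition _ (F : finFieldType) (vT : vectType F) :=
  [Countable of {vspace vT} by <:].
HB.instance Definition _ (F : finFieldType) (vT : vectType F) :=
  [Finite of {vspace vT} by <:].

End FiniteSubspaces.

Section ProjectiveSpace.

Variables (F : finFieldType) (vT : vectType F).

Definition proj_space := {U : {vspace vT} | \dim U == 1%N}.

Lemma dim_line_eq1 (X : vT) : X != 0 -> \dim <[X]> == 1%N.
Proof. by move=> X0; rewrite dim_vline X0. Qed.

Definition proj_point (X : vT) (X0 : X != 0) : proj_space :=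
  exist _ <[X]>%VS (dim_line_eq1 X0).

Variable form : {symmetric vT}.

Definition quad (X : vT) : F := form X X.

(* The spanning vector [vpick] is arbitrary: see [isotropic_point]. *)
Definition isotropic (P : proj_space) : bool := quad (vpick (val P)) == 0.

(* Orthogonality as subspaces; [perp_point] reduces it to spanning vectors. *)
Definition perp (P P' : proj_space) : bool := (val P <= orthov form (val P'))%VS.

Lemma isotropic_point (X : vT) (X0 : X != 0) :
  isotropic (proj_point X0) = (quad X == 0).
Proof.
rewrite /isotropic /quad /=.
have /vlineP[k Yk] := memv_pick <[X]>%VS.
have: vpick <[X]>%VS != 0 by rewrite vpick0 -dimv_eq0 (eqP (dim_line_eq1 X0)).
rewrite Yk scaler_eq0 negb_or => /andP[k0 _].
by rewrite linearZl_LR linearZr_LR /= !mulf_eq0 (negPf k0).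
Qed.

Lemma perp_point (X Y : vT) (X0 : X != 0) (Y0 : Y != 0) :
  perp (proj_point X0) (proj_point Y0) = (form X Y == 0).
Proof. exact: orthov11. Qed.

Definition isotropic_set : {set proj_space} := [set P | isotropic P].
Definition anisotropic_set : {set proj_space} := [set P | ~~ isotropic P].

Definition incidence_mx : 'M[int]_#|{: proj_space}| :=
  \matrix_(i, j) (perp (enum_val i) (enum_val j))%:R.

End ProjectiveSpace.

(* Rows and columns of a matrix indexed by a finite type [T], restricted to
   a subset [S]; both are numbered through the enumerations of [T] and [S]. *)
Definition restrict_mx (R : Type) (T : finType) (S : {set T})
    (M : 'M[R]_#|T|) : 'M[R]_#|S| :=
  mxsub (fun i => enum_rank (enum_val i)) (fun j => enum_rank (enum_val j)) M.

Definition mod2_mx (m n : nat) (M : 'M[int]_(m, n)) : 'M['F_2]_(m, n) :=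
  map_mx intr M.

(* Main.v *)
(* Modulo 2, both [G] and [G_II] square to the identity. The points orthogonal
   to P and Q form a subspace of dimension 3 if P = Q and 2 otherwise, and for
   odd q the parity of the number of points of a subspace is that of its
   dimension; this gives G^2 = 1. For isotropic P and Q, either <P, Q> is a
   totally isotropic line equal to its own orthogonal, with q + 1 points, or
   there is an anisotropic e orthogonal to P and Q: the reflection in e is then
   an involution on the isotropic points orthogonal to P and Q whose only
   possible fixed point is P, and only when P = Q. Finally, the inverse of G
   being G itself, G_AA is nonsingular because the complementary block G_II of
   the inverse is. *)
Require Import Defs.
From mathcomp Require Import all_boot all_algebra all_field.
From mathcomp Require Import ring zify.
Import GRing.Theory.
Local Open Scope ring_scope.

Set Implicit Arguments.
Unset Strict Implicit.
Unset Printing Implicit Defensive.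

(** * Counting modulo 2 with an involution *)

Section Parity.

Variable T : finType.

(** The elements moved by [f] split into pairs x, f x; the induction removes one such pair at a
    time. *)
Lemma odd_card_involution (f : T -> T) (S : {set T}) :
  involutive f -> {in S, forall x, f x \in S} ->
  odd #|S| = odd #|[set x in S | f x == x]|.
Proof.
move=> fK; have [m] := ubnP #|S|; elim: m S => // m IHm S ltSm stabS.
have [/subsetP fixS | /subsetPn[x xS]] :=
    boolP (S \subset [set x in S | f x == x]).
  congr (odd #|pred_of_set _|); apply/eqP; rewrite eqEsubset.
  by apply/andP; split; apply/subsetP=> x; [exact: fixS | rewrite inE => /andP[]].
rewrite inE xS /= => neq_fx.
have fxS : f x \in S :\ x by rewrite !inE neq_fx stabS.
have oddS : odd #|S| = odd #|S :\ x :\ f x|.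
  by rewrite (cardsD1 x) xS (cardsD1 (f x)) fxS /= negbK.
rewrite oddS IHm; first 1 last.
- by rewrite (cardsD1 x) xS (cardsD1 (f x)) fxS in ltSm; rewrite -ltnS ltnW.
- move=> y; rewrite !inE => /and3P[y_fx y_x yS]; rewrite stabS // andbT.
  by rewrite (inj_eq (inv_inj fK)) y_x (can2_eq fK fK) y_fx.
congr (odd #|pred_of_set _|); apply/setP=> y; rewrite !inE.
have [-> | _] /= := eqVneq y (f x); first by rewrite fK eq_sym (negPf neq_fx) andbF.
by have [-> | _] //= := eqVneq y x; rewrite (negPf neq_fx) andbF.
Qed.

End Parity.

(** * Dimensions of orthogonal subspaces *)

Section OrthogonalComplement.

Variables (F : fieldType) (vT : vectType F) (form : {symmetric vT}).

Lemma orthov_add (U W : {vspace vT}) :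
  orthov form (U + W) = (orthov form U :&: orthov form W)%VS.
Proof.
apply/eqP; rewrite eqEsubv subv_cap -orthovD subvv /= orthovD.
by rewrite capvSl capvSr.
Qed.

(** Each vector of a basis of [U] imposes one linear condition, which lowers the dimension by at
    most 1. *)
Lemma dim_capv_orthov (V U : {vspace vT}) :
  (\dim V <= \dim (V :&: orthov form U) + \dim U)%N.
Proof.
rewrite -(size_tuple (vbasis U)) -{1}(span_basis (vbasisP U)).
elim: (tval (vbasis U)) => [|u s IHs] /=.
  by rewrite span_nil orthov0 capvf addn0.
rewrite span_cons addvC orthov_add capvA (leq_trans IHs) // -addSnnS leq_add2r.
by rewrite (leq_trans (leqSpred _)) // ltnS leq_dim_orthov1.
Qed.

Hypothesis ndeg : nondegenerate form.

Lemma dim_orthov (U : {vspace vT}) : (\dim (orthov form U) + \dim U = \dim {:vT})%N.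
Proof.
apply/eqP; rewrite eqn_leq -[X in (_ <= \dim X + _)%N]capfv dim_capv_orthov andbT.
(* For the converse bound: a vector orthogonal to both [U] and its complement is orthogonal to
   everything, hence zero. *)
have := dim_capv_orthov (orthov form U) U^C.
rewrite -orthov_add addv_complf (eqP ndeg) dimv0 add0n => le_dim.
rewrite (leq_trans (leq_add le_dim (leqnn _))) // dimv_compl.
by rewrite subnK // dimvS // subvf.
Qed.

Lemma sub_orthov_eq (U W : {vspace vT}) :
  (\dim U + \dim W = \dim {:vT})%N -> (U <= orthov form W)%VS -> orthov form W = U.
Proof.
move=> dimUW UW; apply/esym/eqP; rewrite eqEdim UW /=.
by rewrite -(leq_add2r (\dim W)) dimUW dim_orthov.
Qed.

(** Polarization: the values of the quadratic form at u, v and u + v determine 2 <u, v>. *)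
Lemma totally_isotropic (U : {vspace vT}) :
  2%:R != 0 :> F -> {in U, forall u, form u u = 0} -> (U <= orthov form U)%VS.
Proof.
move=> two_neq0 isoU; apply/orthovP => u v uU vU.
have := isoU _ (memvD uU vU).
rewrite linearDl !linearDr /= !isoU // add0r addr0 (hermC form v u) expr0 mul1r /=.
by rewrite -mulr2n -mulr_natl => /eqP; rewrite mulf_eq0 (negPf two_neq0) => /eqP.
Qed.

End OrthogonalComplement.

(** * Projective points and their number in a subspace *)

Section Points.

Variables (F : finFieldType) (vT : vectType F).
Implicit Types P Q R : proj_space vT.

Definition rep P : vT := vpick (val P).

Lemma rep_neq0 P : rep P != 0.
Proof. by rewrite vpick0 -dimv_eq0 (eqP (valP P)). Qed.

Lemma val_rep P : val P = <[rep P]>%VS.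
Proof.
apply/esym/eqP; rewrite eqEdim -memvE memv_pick dim_vline rep_neq0.
by rewrite (eqP (valP P)).
Qed.

Lemma eq_point P Q : (P == Q) = (rep P \in val Q).
Proof.
by rewrite -val_eqE /= eqEdim (eqP (valP P)) (eqP (valP Q)) andbT memvE -val_rep.
Qed.

Lemma val_insubd_line P (x : vT) : x != 0 -> val (insubd P <[x]>%VS) = <[x]>%VS.
Proof. by move=> x0; rewrite insubdK //; apply: dim_line_eq1. Qed.

Lemma rep_insubd_line P (x : vT) : x != 0 ->
  exists2 k, k != 0 & rep (insubd P <[x]>%VS) = k *: x.
Proof.
move=> x0; have: rep (insubd P <[x]>%VS) \in val (insubd P <[x]>%VS) := memv_pick _.
rewrite val_insubd_line // => /vlineP[k def_k]; exists k => //.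
apply: contraNneq (rep_neq0 (insubd P <[x]>%VS)) => k0.
by rewrite def_k k0 scale0r.
Qed.

Lemma perp_rep (form : {symmetric vT}) P Q :
  perp form P Q = (form (rep P) (rep Q) == 0).
Proof. by rewrite /perp !val_rep orthov11. Qed.

Lemma perp_sym (form : {symmetric vT}) : symmetric (perp form).
Proof. by move=> P Q; rewrite /perp orthov_sym. Qed.

Lemma dim_add_points P Q : \dim (val P + val Q) = (P != Q).+1.
Proof.
have [-> | neqPQ] := eqVneq; first by rewrite addvv (eqP (valP Q)).
rewrite dimv_disjoint_sum ?(eqP (valP P)) ?(eqP (valP Q)) //.
apply/eqP; rewrite -subv0; apply/subvP=> v; rewrite memv_cap memv0 => /andP[].
rewrite (val_rep P) => /vlineP[k ->]; apply: contraTT; rewrite scaler_eq0 negb_or.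
by case/andP=> k0 _; rewrite rpredZeq (negPf k0) -eq_point.
Qed.

End Points.

(** With q = #|F| and k the dimension of [U], there are 1 + q + ... + q^(k-1) points: k terms, all
    odd. *)
Lemma odd_card_points (F : finFieldType) (n : nat) (U : {vspace 'rV[F]_n}) :
  odd #|F| -> odd #|[set P : proj_space 'rV[F]_n | (val P <= U)%VS]| = odd (\dim U).
Proof.
move=> oddF; set S := [set P | _].
have q_gt1 : (1 < #|F|)%N := finNzRing_gt1 F.
have cardU : (#|U|.-1 = #|S| * #|F|.-1)%N.
  have card_nz (W : {vspace 'rV[F]_n}) : #|[pred x in W | x != 0]| = #|W|.-1.
    by rewrite (cardD1 0 W) mem0v; apply: eq_card => x; rewrite !inE andbC.
  rewrite -card_nz -[LHS]sum1_card.
  (* Double count of pairs (x, P) with x nonzero in P: each x spans exactly one point, each P holds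
     q - 1 such x. *)
  transitivity (\sum_(x in [pred x in U | x != 0%R]) \sum_(P in S) (x \in val P))%N.
    apply: eq_bigr => x; rewrite inE => /andP[xU x0].
    rewrite (bigD1 (proj_point x0)) /=; last by rewrite inE /= -memvE.
    rewrite memv_line big1 // => P /andP[_]; apply: contraNeq.
    rewrite eqb0 negbK => xP; rewrite -val_eqE /= eq_sym eqEdim -memvE xP.
    by rewrite dim_vline x0 (eqP (valP P)).
  rewrite exchange_big /= -sum_nat_const; apply: eq_bigr => P.
  rewrite inE => /subvP PU.
  have -> : #|F|.-1 = #|[pred x in val P | x != 0]|.
    by rewrite card_nz card_vspace (eqP (valP P)) expn1.
  rewrite -[RHS]sum1_card big_mkcond [RHS]big_mkcond /=.
  apply: eq_bigr => x _; rewrite !inE; case: (boolP (x \in val P)) => [/PU-> //|_].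
  by rewrite if_same.
have -> : #|S| = (\sum_(i < \dim U) #|F| ^ i)%N.
  apply/eqP; rewrite -(@eqn_pmul2r #|F|.-1) ?ltn_predRL //.
  by rewrite -cardU card_vspace predn_exp mulnC.
elim: (\dim U) => [|k IHk]; first by rewrite big_ord0.
by rewrite big_ord_recr /= oddD IHk oddX oddF orbT addbT.
Qed.

(** * The reflection in an anisotropic vector, acting on points *)

Section Reflection.

Variables (F : finFieldType) (vT : vectType F) (form : {symmetric vT}).
Hypothesis two_neq0 : 2%:R != 0 :> F.
Variable e : vT.
Hypothesis e_aniso : form e e != 0.
Implicit Types P Q R : proj_space vT.

Lemma form_sym (x y : vT) : form x y = form y x.
Proof. by rewrite hermC expr0 mul1r. Qed.

Definition reflection (x : vT) : vT := x - (2%:R * form x e / form e e) *: e.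

Lemma reflectionZ k x : reflection (k *: x) = k *: reflection x.
Proof.
rewrite /reflection linearZl_LR /= scalerBr scalerA !mulrA.
by rewrite (mulrC k).
Qed.

Lemma form_reflection_e x : form (reflection x) e = - form x e.
Proof.
rewrite /reflection linearBl linearZl_LR /= divfK // mulrDl mul1r.
by rewrite opprD addNKr.
Qed.

Lemma reflectionK : involutive reflection.
Proof.
move=> x; rewrite {1}/reflection form_reflection_e mulrN mulNr scaleNr opprK.
exact: subrK.
Qed.

Lemma reflection_neq0 x : x != 0 -> reflection x != 0.
Proof.
apply: contraNneq => sx0.
by rewrite -(reflectionK x) sx0 -(scale0r e) reflectionZ !scale0r.
Qed.

Lemma form_reflection_r x y : form x e = 0 -> form x (reflection y) = form x y.
Proof. by move=> xe0; rewrite linearBr linearZr_LR /= xe0 mulr0 subr0. Qed.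

Lemma form_reflection x : form (reflection x) (reflection x) = form x x.
Proof.
rewrite {2}/reflection linearBr linearZr_LR /= form_reflection_e.
rewrite /reflection linearBl linearZl_LR /= (form_sym e x).
by field.
Qed.

(** The default [P] of [insubd] is never returned, since the reflection of a nonzero vector is
    nonzero. *)
Definition reflect_point P : proj_space vT := insubd P <[reflection (rep P)]>%VS.

Lemma rep_reflect_point P :
  exists2 k, k != 0 & rep (reflect_point P) = k *: reflection (rep P).
Proof. exact/rep_insubd_line/reflection_neq0/rep_neq0. Qed.

Lemma reflect_pointK : involutive reflect_point.
Proof.
move=> P; apply/eqP; rewrite eq_point val_rep.
have [k _ ->] := rep_reflect_point (reflect_point P).
have [l _ ->] := rep_reflect_point P; rewrite reflectionZ reflectionK scalerA.
by rewrite memvZ ?memv_line.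
Qed.

Lemma isotropic_reflect_point P : isotropic form (reflect_point P) = isotropic form P.
Proof.
rewrite /isotropic /quad -!/(rep _); have [k k0 ->] := rep_reflect_point P.
by rewrite linearZl_LR linearZr_LR /= form_reflection !mulf_eq0 (negPf k0).
Qed.

Lemma perp_reflect_point P R :
  form (rep P) e = 0 -> perp form P (reflect_point R) = perp form P R.
Proof.
move=> Pe0; rewrite !perp_rep; have [k k0 ->] := rep_reflect_point R.
by rewrite linearZr_LR /= form_reflection_r // mulf_eq0 (negPf k0).
Qed.

(** If r = k s(r) for the reflection s, pairing with the isotropic r gives 2 k <r, e>^2 / <e, e> =
    0, where k is nonzero because r is. *)
Lemma reflect_point_fixed R :
  isotropic form R -> (reflect_point R == R) = (form (rep R) e == 0).
Proof.
rewrite /isotropic /quad -/(rep R) => isoR; rewrite eq_sym eq_point.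
rewrite val_insubd_line ?reflection_neq0 ?rep_neq0 //.
apply/vlineP/eqP=> [[k def_r] | re0]; last first.
  by exists 1; rewrite scale1r /reflection re0 mulr0 mul0r scale0r subr0.
have /eqP := congr1 (form (rep R)) def_r.
rewrite (eqP isoR) linearZr_LR linearBr linearZr_LR /= (eqP isoR) sub0r eq_sym.
rewrite mulrN oppr_eq0 !mulf_eq0 invr_eq0
  (negPf e_aniso) (negPf two_neq0) /= orbF orbb.
case/orP=> /eqP // k0.
by have := rep_neq0 R; rewrite def_r k0 scale0r eqxx.
Qed.

End Reflection.

(* If [2 = 0], then [x |-> x + 1] is an involution without fixed points. *)
Lemma odd_two_neq0 (F : finFieldType) : odd #|F| -> 2%:R != 0 :> F.
Proof.
apply: contraL => /eqP two0.
have addK : involutive (fun x : F => x + 1).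
  by move=> x; rewrite -addrA -[1 + 1]/2%:R two0 addr0.
rewrite -cardsT (odd_card_involution addK) //.
rewrite (_ : [set x in _ | _] = set0) ?cards0 //.
by apply/setP=> x; rewrite !inE -subr_eq0 addrC addKr oner_eq0.
Qed.

(** * Parity of the number of points orthogonal to two given points *)

Section PolarSpace.

Variables (F : finFieldType) (vT : vectType F) (form : {symmetric vT}).
Hypotheses (oddF : odd #|F|) (ndeg : nondegenerate form) (dim4 : \dim {:vT} = 4).
(* Assumed for an abstract [vT]: [odd_card_points] needs vectors forming a [finType]. *)
Hypothesis odd_points : forall U : {vspace vT},
  odd #|[set P : proj_space vT | (val P <= U)%VS]| = odd (\dim U).
Implicit Types P Q R : proj_space vT.

Let dimV (U : {vspace vT}) : (\dim (orthov form U) + \dim U = 4)%N.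
Proof. by rewrite dim_orthov. Qed.

Lemma isotropic_perp P : isotropic form P = perp form P P.
Proof. by rewrite perp_rep. Qed.

Lemma odd_card_perp P Q :
  odd #|[set R | perp form P R && perp form R Q]| = (P == Q).
Proof.
rewrite (_ : [set R | _] = [set R | (val R <= orthov form (val P + val Q))%VS]).
  rewrite odd_points.
  by have := dimV (val P + val Q); rewrite dim_add_points; case: eqVneq => _;
      case: (\dim _) => [|[|[|[|[]]]]].
by apply/setP=> R; rewrite !inE orthovD perp_sym.
Qed.

Lemma anisotropic_mem_perp P Q : isotropic form P -> isotropic form Q ->
  ~~ (perp form P Q && (P != Q)) ->
  exists e, [/\ form e e != 0, form (rep P) e = 0 & form (rep Q) e = 0].
Proof.
(* Otherwise the orthogonal [W] of <P, Q> would be totally isotropic, so of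
   dimension 2 and equal to its own orthogonal, which contains P and Q. *)
move=> isoP isoQ; set W := orthov form (val P + val Q).
have memW e : e \in W -> form (rep P) e = 0 /\ form (rep Q) e = 0.
  rewrite memvE orthovD !val_rep !orthov11 !(herm_eq0C form e).
  by case/andP=> /eqP-> /eqP->.
have [R /andP[RW anisoR] _ | isoW] :=
    pickP [pred R | (val R <= W)%VS && ~~ isotropic form R].
  by exists (rep R); have [] := memW (rep R); rewrite ?memvE -?val_rep.
have WW : (W <= orthov form W)%VS.
  apply: totally_isotropic (odd_two_neq0 oddF) _ => u uW.
  have [-> | u0] := eqVneq u 0; first exact: linear0r.
  have /= := isoW (proj_point u0).
  by rewrite isotropic_point -memvE uW /= => /negbFE/eqP.
have := dimvS WW; have := dimV W; have := dimV (val P + val Q).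
rewrite -/W dim_add_points => dimW dimWW leW.
(* P = Q would give [W] dimension 3, but a subspace of its own orthogonal has dimension at most
   2. *)
have PQ : P != Q.
  by move: dimW dimWW leW; case: eqVneq => //= _; lia.
rewrite PQ andbT => /negP[].
have W2 : (\dim W + \dim W = 4)%N by move: dimW; rewrite PQ; lia.
have UW : (val P + val Q <= W)%VS.
  by rewrite -(sub_orthov_eq ndeg _ WW) ?dim4 // orthov_sym.
by move: UW; rewrite subv_add orthovD => /andP[/andP[_]].
Qed.

Lemma odd_card_isotropic_perp P Q : isotropic form P -> isotropic form Q ->
  odd #|[set R in isotropic_set form | perp form P R && perp form R Q]| = (P == Q).
Proof.
move=> isoP isoQ; set S := [set R in _ | _].
have [/andP[PQ neqPQ] | nPQ] := boolP (perp form P Q && (P != Q)).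
  (* <P, Q> is its own orthogonal: all points orthogonal to P and Q are isotropic. *)
  have UU : (val P + val Q <= orthov form (val P + val Q))%VS.
    rewrite subv_add !orthovD -!/(perp _ _ _) -!isotropic_perp isoP isoQ PQ.
    by rewrite perp_sym PQ.
  have eqU : orthov form (val P + val Q) = (val P + val Q)%VS.
    by apply: sub_orthov_eq => //; rewrite dim4 dim_add_points neqPQ.
  rewrite -odd_card_perp; congr (odd #|pred_of_set _|); apply/setP=> R.
  rewrite !inE andb_idl // => /andP[PR RQ].
  have RU : (val R <= val P + val Q)%VS
    by rewrite -eqU orthovD -!/(perp _ _ _) (perp_sym _ R P) PR.
  by rewrite isotropic_perp /perp (subv_trans RU) // -orthov_sym (subv_trans RU).
have [e [e0 Pe Qe]] := anisotropic_mem_perp isoP isoQ nPQ.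
rewrite (odd_card_involution (reflect_pointK e0)) => [|R]; last first.
  rewrite !inE => /and3P[isoR PR RQ].
  rewrite isotropic_reflect_point // isoR perp_reflect_point // PR.
  by rewrite perp_sym perp_reflect_point // perp_sym.
have fixedS R : (R \in [set R in S | reflect_point form e R == R]) =
    [&& isotropic form R, perp form P R, perp form R Q & form (rep R) e == 0].
  rewrite !inE; case isoR: (isotropic form R) => //=.
  by rewrite reflect_point_fixed ?odd_two_neq0 // andbA.
have [eqPQ | neqPQ] := eqVneq P Q.
  subst Q; rewrite (_ : [set R in S | _] = [set P]) ?cards1 //.
  apply/setP=> R; rewrite fixedS inE; have [-> | neqRP] := eqVneq R P.
    by rewrite isoP -isotropic_perp isoP Pe eqxx.
  apply/and4P=> -[isoR PR RP /eqP re0].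
  (* A fixed R other than P would make <R, P> a totally isotropic line equal to its own orthogonal.
     That orthogonal contains [e], so [e] would be orthogonal to itself. *)
  have XX : (val R + val P <= orthov form (val R + val P))%VS.
    by rewrite subv_add !orthovD -!/(perp _ _ _) -!isotropic_perp isoP isoR PR RP.
  have eX : (<[e]> <= orthov form (val R + val P))%VS.
    by rewrite orthovD !val_rep !orthov11 !(herm_eq0C form e) re0 Pe eqxx.
  have eX' := eX.
  rewrite (sub_orthov_eq ndeg _ XX) ?dim4 ?dim_add_points ?neqRP // in eX'.
  have := subv_trans eX' XX; rewrite orthov_sym => /(subv_trans eX').
  by rewrite orthov11 (negPf e0).
rewrite (_ : [set R in S | _] = set0) ?cards0 //.
apply/setP=> R; rewrite fixedS inE; apply/and4P=> -[isoR PR RQ /eqP re0].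
move: nPQ; rewrite neqPQ andbT => nPQ.
(* Pairing k r = a p + b q with p and q gives b <p, q> = 0 and a <p, q> = 0, while <p, q> is nonzero
   here. *)
have RU0 : (val R :&: (val P + val Q) = 0)%VS.
  apply/eqP; rewrite -subv0; apply/subvP=> v; rewrite memv_cap memv0.
  rewrite !val_rep => /andP[/vlineP[k ->] /memv_addP[_ /vlineP[a ->]]].
  case=> _ /vlineP[b ->] def_v.
  move: PR RQ nPQ; rewrite !perp_rep => /eqP pr0 /eqP rq0 pq.
  have := isoP; have := isoQ.
  rewrite /isotropic /quad -!/(rep _) => /eqP qq0 /eqP pp0.
  have := congr1 (form^~ (rep Q)) def_v; have := congr1 (form (rep P)) def_v.
  rewrite linearDl linearDr !linearZl_LR !linearZr_LR /=.
  rewrite pr0 rq0 pp0 qq0 !mulr0 add0r addr0.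
  move=> /esym/eqP; rewrite mulf_eq0 (negPf pq) orbF => /eqP b0.
  move=> /esym/eqP; rewrite mulf_eq0 (negPf pq) orbF => /eqP a0.
  by rewrite def_v a0 b0 !scale0r addr0.
have dimX : \dim (val R + (val P + val Q)) = 3.
  by rewrite dimv_disjoint_sum // dim_add_points neqPQ (eqP (valP R)).
have RX : (val R <= orthov form (val R + (val P + val Q)))%VS.
  by rewrite !orthovD -!/(perp _ _ _) -isotropic_perp isoR perp_sym PR.
(* The orthogonal of the 3-dimensional <R, P, Q> is a single point containing R, hence R itself. It
   also contains [e], which would then be isotropic. *)
have : e \in val R.
  rewrite -(sub_orthov_eq ndeg _ RX) ?dim4 ?dimX ?(eqP (valP R)) //.
  by rewrite memvE !orthovD !val_rep !orthov11 !(herm_eq0C form e) re0 Pe Qe eqxx.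
rewrite val_rep => /vlineP[k def_e]; case/negP: e0; rewrite def_e.
rewrite linearZl_LR linearZr_LR /=; move: isoR.
by rewrite /isotropic /quad -/(rep R) => /eqP->; rewrite !mulr0.
Qed.

End PolarSpace.

(** * From parity counts to ranks over the field with two elements *)

Section RestrictedRank.

Variables (T : finType) (r : rel T).

Let g x y : 'F_2 := (r x y)%:R.

Lemma sum_char2_card (P : pred T) (p q : pred T) :
  \sum_(k in P) (p k)%:R * (q k)%:R = (odd #|[set k in P | p k && q k]|)%:R :> 'F_2.
Proof.
have -> n : (odd n)%:R = n%:R :> 'F_2.
  by rewrite -modn2 (GRing.natr_mod_pchar (pchar_Fp _)).
rewrite -sum1dep_card natr_sum big_mkcondr.
by apply: eq_bigr => k _; rewrite -natrM mulnb; case: (_ && _).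
Qed.

(** Full rank means a trivial left kernel; phrasing this with functions on [T] keeps enumeration
    indices out of the later arguments. *)
Lemma rank_restrict_mx (M : 'M[int]_#|T|) (S : {set T}) :
  (forall i j, M i j = (r (enum_val i) (enum_val j))%:R) ->
  (forall f : T -> 'F_2,
     {in S, forall j, \sum_(k in S) f k * g k j = 0} -> {in S, f =1 fun=> 0}) ->
  \rank (mod2_mx (restrict_mx S M)) = #|S|.
Proof.
move=> defM injS; apply/eqP; rewrite -[_ == _]/(row_free _) -kermx_eq0.
apply/rowV0P=> v /sub_kermxP vG0.
(* This extends [v] by zero outside [S]: the sum has one term on [S] and none elsewhere. *)
pose f k := \sum_(i | enum_val i == k) v 0 i.
have fE i : f (enum_val i) = v 0 i.
  rewrite /f (eq_bigl (pred1 i)) ?big_pred1_eq // => j.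
  by rewrite (inj_eq enum_val_inj).
apply/rowP=> i; rewrite mxE -fE injS ?enum_valP // => j jS.
rewrite (big_enum_val (fun k => f k * g k j)).
have := congr1 (fun w : 'rV_#|S| => w 0 (enum_rank_in jS j)) vG0.
rewrite !mxE => Gj; rewrite -[RHS]Gj; apply: eq_bigr => k _.
by rewrite fE !mxE defM !enum_rankK enum_rankK_in // natz.
Qed.

(** Exchanging the sums in the double product f G G exposes the entries of G^2, which modulo 2 are
    the parities counted above. *)
Lemma sum_mulr_pairs (D E : {set T}) (f : T -> 'F_2) j :
  \sum_(k in D) (\sum_(i in E) f i * g i k) * g k j =
  \sum_(i in E) f i * (odd #|[set k in D | r i k && r k j]|)%:R.
Proof.
under eq_bigr do rewrite mulr_suml.
rewrite exchange_big; apply: eq_bigr => i _; under eq_bigr do rewrite -mulrA.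
by rewrite -mulr_sumr sum_char2_card.
Qed.

Lemma sum_mulr_delta (E : {set T}) (f : T -> 'F_2) j :
  \sum_(i in E) f i * (i == j)%:R = if j \in E then f j else 0.
Proof.
rewrite big_mkcond (bigD1 j) //= eqxx mulr1 big1 ?addr0 // => i /negPf->.
by rewrite mulr0 if_same.
Qed.

Section OrthonormalRows.

Variable S : {set T}.
Hypothesis oddS :
  {in S &, forall i j, odd #|[set k in S | r i k && r k j]| = (i == j)}.

(** By [oddS], G restricted to [S] is its own inverse, so f = (f G) G = 0 on [S]. *)
Lemma orthonormal_inj (f : T -> 'F_2) :
  {in S, forall j, \sum_(k in S) f k * g k j = 0} -> {in S, f =1 fun=> 0}.
Proof.
move=> fg0 j jS.
transitivity (\sum_(k in S) (\sum_(i in S) f i * g i k) * g k j); last first.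
  by rewrite big1 // => k kS; rewrite fg0 // mul0r.
rewrite sum_mulr_pairs (eq_bigr (fun i => f i * (i == j)%:R)) => [|i iS].
  by rewrite sum_mulr_delta jS.
by rewrite oddS.
Qed.

(* The product [h := f G] is supported on [S] and [h G = f] vanishes on [S], so
   [h] is killed by [G] restricted to [S]: hence [h = 0] and [f = h G = 0]. *)
Lemma orthonormal_compl_inj (f : T -> 'F_2) :
  (forall i j, odd #|[set k | r i k && r k j]| = (i == j)) ->
  {in ~: S, forall j, \sum_(k in ~: S) f k * g k j = 0} -> {in ~: S, f =1 fun=> 0}.
Proof.
move=> oddT fg0; pose h j := \sum_(k in ~: S) f k * g k j.
have hg j : \sum_(k in S) h k * g k j = if j \in ~: S then f j else 0.
  rewrite -sum_mulr_delta; transitivity (\sum_(k in setT) h k * g k j).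
    rewrite big_mkcond [RHS]big_mkcond; apply: eq_bigr => k _; rewrite inE.
    by case: ifPn => // kS; rewrite /h fg0 ?mul0r // inE.
  rewrite sum_mulr_pairs; apply: eq_bigr => i _; congr (_ * (nat_of_bool _)%:R).
  by rewrite -oddT; congr (odd #|pred_of_set _|); apply/setP=> k; rewrite !inE.
have h0 : {in S, h =1 fun=> 0}.
  by apply: orthonormal_inj => j jS; rewrite hg inE jS.
move=> j jS; transitivity (\sum_(k in S) h k * g k j); first by rewrite hg jS.
by rewrite big1 // => k kS; rewrite h0 // mul0r.
Qed.

End OrthonormalRows.

End RestrictedRank.

Theorem theorem1p1 (F : finFieldType) (hq : odd #|F|)
    (form : {symmetric 'rV[F]_4}) (hform : nondegenerate form) :
  let G := incidence_mx form in
  let I := isotropic_set form in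
  let A := anisotropic_set form in
  let G_II := restrict_mx I G in
  let G_AA := restrict_mx A G in
  \rank (mod2_mx G_II) = #|I| /\ \rank (mod2_mx G_AA) = #|A|.
Proof.
move=> G I A G_II G_AA.
have dim4 : \dim {:'rV[F]_4} = 4 by rewrite dimvf.
have points (U : {vspace 'rV[F]_4}) := odd_card_points U hq.
have defG i j : G i j = (perp form (enum_val i) (enum_val j))%:R by rewrite mxE.
have oddI : {in I &, forall P Q,
    odd #|[set R in I | perp form P R && perp form R Q]| = (P == Q)}.
  by move=> P Q; rewrite !inE => isoP isoQ; apply: odd_card_isotropic_perp.
split; apply: (rank_restrict_mx defG) => f; first exact: orthonormal_inj.
have -> : A = ~: I by apply/setP=> P; rewrite !inE.
apply: orthonormal_compl_inj oddI _ _ => P Q; exact: odd_card_perp.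
Qed.
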